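(* Let $\mathbb{KC}=((G,R),(M,S),I)$ be a reflexive and transitive Kripke context. Then the following hold. 1. $\underline{\mathfrak{P}}^{+}(\mathbb{KC})$ is a topological contextual dBa. 2. $\underline{\mathfrak{P}}^{+}(\mathbb{KC})_{p}=\underline{\mathfrak{H}}^{+}(\mathbb{KC})$ is a topological pure dBa.
   Context: **Double Boolean algebras.** A double Boolean algebra (dBa) is an algebra $\mathbf{D}=(D,\sqcup,\sqcap,\neg,\lrcorner,\top,\bot)$ such that, writing $x\vee y:=\neg(\neg x\sqcap\neg y)$ and $x\wedge y:=\lrcorner(\lrcorner x\sqcup\lrcorner y)$, for all $x,y,z\in D$: (1a) $(x\sqcap x)\sqcap y=x\sqcap y$; (1b) $(x\sqcup x)\sqcup y=x\sqcup y$; (2a) $x\sqcap y=y\sqcap x$; (2b) $x\sqcup y=y\sqcup x$; (3a) $x\sqcap(y\sqcap z)=(x\sqcap y)\sqcap z$; (3b) $x\sqcup(y\sqcup z)=(x\sqcup y)\sqcup z$; (4a) $\neg(x\sqcap x)=\neg x$; (4b) $\lrcorner(x\sqcup x)=\lrcorner x$; (5a) $x\sqcap(x\sqcup y)=x\sqcap x$; (5b) $x\sqcup(x\sqcap y)=x\sqcup x$; (6a) $x\sqcap(y\vee z)=(x\sqcap y)\vee(x\sqcap z)$; (6b) $x\sqcup(y\wedge z)=(x\sqcup y)\wedge(x\sqcup z)$; (7a) $x\sqcap(x\vee y)=x\sqcap x$; (7b) $x\sqcup(x\wedge y)=x\sqcup x$; (8a) $\neg\neg(x\sqcap y)=x\sqcap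 y$; (8b) $\lrcorner\lrcorner(x\sqcup y)=x\sqcup y$; (9a) $x\sqcap\neg x=\bot$; (9b) $x\sqcup\lrcorner x=\top$; (10a) $\neg\bot=\top\sqcap\top$; (10b) $\lrcorner\top=\bot\sqcup\bot$; (11a) $\neg\top=\bot$; (11b) $\lrcorner\bot=\top$; (12) $(x\sqcap x)\sqcup(x\sqcap x)=(x\sqcup x)\sqcap(x\sqcup x)$. The quasi-order is: $x\sqsubseteq y$ iff $x\sqcap y=x\sqcap x$ and $x\sqcup y=y\sqcup y$. $\mathbf{D}$ is contextual if $\sqsubseteq$ is a partial order, and pure if for each $x\in D$, $x\sqcap x=x$ or $x\sqcup x=x$. $D_p:=\{x\in D: x\sqcap x=x\text{ or }x\sqcup x=x\}$. **dBao and topological dBa.** A dBa with operators (dBao) is $\mathfrak{O}=(D,\sqcup,\sqcap,\neg,\lrcorner,\top,\bot,\mathbf{I},\mathbf{C})$ where the reduct without $\mathbf{I},\mathbf{C}$ is a dBa and $\mathbf{I},\mathbf{C}:D\to D$ are monotone with respect to $\sqsubseteq$ and satisfy, for all $x,y$: $\mathbf{I}(x\sqcap y)=\mathbf{I}(x)\sqcap\mathbf{I}(y)$, $\mathbf{C}(x\sqcup y)=\mathbf{C}(x)\sqcup\mathbf{C}(y)$, $\mathbf{I}(\neg\bot)=\neg\bot$, $\mathbf{C}(\lrcorner\top)=\lrcorner\top$, $\mathbf{I}(x\sqcap x)=\mathbf{I}(x)$, $\mathbf{C}(x\sqcup x)=\mathbf{C}(x)$. A topological dBa is a dBao that also satisfies,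 for all $x$: $\mathbf{I}(x)\sqsubseteq x$, $x\sqsubseteq\mathbf{C}(x)$, $\mathbf{I}\mathbf{I}(x)=\mathbf{I}(x)$, $\mathbf{C}\mathbf{C}(x)=\mathbf{C}(x)$. A topological contextual (pure) dBa is a topological dBa whose underlying dBa is contextual (pure). $\mathfrak{O}_p$ denotes the subalgebra of $\mathfrak{O}$ with universe $D_p$. **Contexts and protoconcepts.** A context is $\mathbb{K}=(G,M,I)$ with $G,M$ sets and $I\subseteq G\times M$. For $A\subseteq G$, $A':=\{m\in M: gIm\text{ for all }g\in A\}$; for $B\subseteq M$, $B':=\{g\in G: gIm\text{ for all }m\in B\}$. A pair $(A,B)$ with $A\subseteq G$, $B\subseteq M$ is a protoconcept if $A''=B'$ (equivalently $A'=B''$), and a semiconcept if $A'=B$ or $B'=A$; $\mathfrak{P}(\mathbb{K})$, $\mathfrak{H}(\mathbb{K})$ are the sets of protoconcepts and semiconcepts, and $\mathfrak{H}(\mathbb{K})\subseteq\mathfrak{P}(\mathbb{K})$. Operations on $\mathfrak{P}(\mathbb{K})$: $(A_1,B_1)\sqcap(A_2,B_2):=(A_1\cap A_2,(A_1\cap A_2)')$, $(A_1,B_1)\sqcup(A_2,B_2):=((B_1\cap B_2)',B_1\cap B_2)$, $\neg(A,B):=(G\setminus A,(G\setminus A)')$, $\lrcorner(A,B):=((M\setminus B)',M\setminus B)$, $\top:=(G,\emptyset)$, $\bot:=(\emptyset,M)$. **Kripke contexts.** A Kripke context based on $\mathbb{K}=(G,M,I)$ is $\mathbb{KC}=((G,R),(M,S),I)$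 with $R$, $S$ binary relations on $G$, $M$. It is reflexive (transitive) if both $R$ and $S$ are reflexive (transitive). For a binary relation $E$ on $W$ and $A\subseteq W$, $\underline{A}_E:=\{x\in W:\forall y\,(xEy\Rightarrow y\in A)\}$. For $(A,B)\in\mathfrak{P}(\mathbb{K})$, $f_R((A,B)):=(\underline{A}_R,(\underline{A}_R)')$ and $f_S((A,B)):=((\underline{B}_S)',\underline{B}_S)$. $\underline{\mathfrak{P}}^{+}(\mathbb{KC}):=(\mathfrak{P}(\mathbb{K}),\sqcup,\sqcap,\neg,\lrcorner,\top,\bot,f_R,f_S)$ and $\underline{\mathfrak{H}}^{+}(\mathbb{KC}):=(\mathfrak{H}(\mathbb{K}),\sqcup,\sqcap,\neg,\lrcorner,\top,\bot,f_R|_{\mathfrak{H}(\mathbb{K})},f_S|_{\mathfrak{H}(\mathbb{K})})$, with $f_R$, $f_S$ in the roles of $\mathbf{I}$, $\mathbf{C}$. *)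

(* Defs.v *)
From mathcomp Require Import all_boot.
From mathcomp Require Import boolp classical_sets.

Set Implicit Arguments.
Unset Strict Implicit.
Unset Printing Implicit Defensive.

Local Open Scope classical_set_scope.

(** An algebra on a set [carrier D] of elements of an ambient type [T].  The
    operations are total on [T], but only their values on [carrier D] matter:
    closure of the carrier is part of [is_dba] and [is_dbao], and every axiom
    quantifies over elements of the carrier.  An algebra on a whole type has
    [carrier D = setT]; a subalgebra has the same operations and a smaller
    carrier. *)
Record dba_sig (T : Type) := DbaSig {
  carrier : set T;
  join : T -> T -> T;
  meet : T -> T -> T;
  neg : T -> T;
  opp : T -> T;
  top : T;
  bot : T
}.

Definition vee T (D : dba_sig T) (x y : T) : T :=
  neg D (meet D (neg D x) (neg D y)).

Definition wedge T (D : dba_sig T) (x y : T) : T :=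
  opp D (join D (opp D x) (opp D y)).

Record is_dba T (D : dba_sig T) : Prop := IsDba {
  join_closed : forall x y, carrier D x -> carrier D y -> carrier D (join D x y);
  meet_closed : forall x y, carrier D x -> carrier D y -> carrier D (meet D x y);
  neg_closed : forall x, carrier D x -> carrier D (neg D x);
  opp_closed : forall x, carrier D x -> carrier D (opp D x);
  top_closed : carrier D (top D);
  bot_closed : carrier D (bot D);
  dba1a : forall x y, carrier D x -> carrier D y ->
    meet D (meet D x x) y = meet D x y;
  dba1b : forall x y, carrier D x -> carrier D y ->
    join D (join D x x) y = join D x y;
  dba2a : forall x y, carrier D x -> carrier D y -> meet D x y = meet D y x;
  dba2b : forall x y, carrier D x -> carrier D y -> join D x y = join D y x;
  dba3a : forall x y z, carrier D x -> carrier D y -> carrier D z ->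
    meet D x (meet D y z) = meet D (meet D x y) z;
  dba3b : forall x y z, carrier D x -> carrier D y -> carrier D z ->
    join D x (join D y z) = join D (join D x y) z;
  dba4a : forall x, carrier D x -> neg D (meet D x x) = neg D x;
  dba4b : forall x, carrier D x -> opp D (join D x x) = opp D x;
  dba5a : forall x y, carrier D x -> carrier D y ->
    meet D x (join D x y) = meet D x x;
  dba5b : forall x y, carrier D x -> carrier D y ->
    join D x (meet D x y) = join D x x;
  dba6a : forall x y z, carrier D x -> carrier D y -> carrier D z ->
    meet D x (vee D y z) = vee D (meet D x y) (meet D x z);
  dba6b : forall x y z, carrier D x -> carrier D y -> carrier D z ->
    join D x (wedge D y z) = wedge D (join D x y) (join D x z);
  dba7a : forall x y, carrier D x -> carrier D y ->
    meet D x (vee D x y) = meet D x x;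
  dba7b : forall x y, carrier D x -> carrier D y ->
    join D x (wedge D x y) = join D x x;
  dba8a : forall x y, carrier D x -> carrier D y ->
    neg D (neg D (meet D x y)) = meet D x y;
  dba8b : forall x y, carrier D x -> carrier D y ->
    opp D (opp D (join D x y)) = join D x y;
  dba9a : forall x, carrier D x -> meet D x (neg D x) = bot D;
  dba9b : forall x, carrier D x -> join D x (opp D x) = top D;
  dba10a : neg D (bot D) = meet D (top D) (top D);
  dba10b : opp D (top D) = join D (bot D) (bot D);
  dba11a : neg D (top D) = bot D;
  dba11b : opp D (bot D) = top D;
  dba12 : forall x, carrier D x ->
    join D (meet D x x) (meet D x x) = meet D (join D x x) (join D x x)
}.

Definition sqle T (D : dba_sig T) (x y : T) : Prop :=
  meet D x y = meet D x x /\ join D x y = join D y y.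

Record contextual T (D : dba_sig T) : Prop := Contextual {
  sqle_refl : forall x, carrier D x -> sqle D x x;
  sqle_trans : forall x y z, carrier D x -> carrier D y -> carrier D z ->
    sqle D x y -> sqle D y z -> sqle D x z;
  sqle_antisym : forall x y, carrier D x -> carrier D y ->
    sqle D x y -> sqle D y x -> x = y
}.

Definition pure T (D : dba_sig T) : Prop :=
  forall x, carrier D x -> meet D x x = x \/ join D x x = x.

Definition dba_p T (D : dba_sig T) : set T :=
  [set x | carrier D x /\ (meet D x x = x \/ join D x x = x)].

Record dbao_sig (T : Type) := DbaoSig {
  reduct :> dba_sig T;
  opI : T -> T;
  opC : T -> T
}.

Record is_dbao T (O : dbao_sig T) : Prop := IsDbao {
  dbao_dba : is_dba O;
  opI_closed : forall x, carrier O x -> carrier O (opI O x);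
  opC_closed : forall x, carrier O x -> carrier O (opC O x);
  opI_mono : forall x y, carrier O x -> carrier O y ->
    sqle O x y -> sqle O (opI O x) (opI O y);
  opC_mono : forall x y, carrier O x -> carrier O y ->
    sqle O x y -> sqle O (opC O x) (opC O y);
  opI_meet : forall x y, carrier O x -> carrier O y ->
    opI O (meet O x y) = meet O (opI O x) (opI O y);
  opC_join : forall x y, carrier O x -> carrier O y ->
    opC O (join O x y) = join O (opC O x) (opC O y);
  opI_neg_bot : opI O (neg O (bot O)) = neg O (bot O);
  opC_opp_top : opC O (opp O (top O)) = opp O (top O);
  opI_meetxx : forall x, carrier O x -> opI O (meet O x x) = opI O x;
  opC_joinxx : forall x, carrier O x -> opC O (join O x x) = opC O x
}.

Record topological_dba T (O : dbao_sig T) : Prop := TopologicalDba {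
  topological_dbao : is_dbao O;
  opI_sqle : forall x, carrier O x -> sqle O (opI O x) x;
  opC_sqge : forall x, carrier O x -> sqle O x (opC O x);
  opI_idem : forall x, carrier O x -> opI O (opI O x) = opI O x;
  opC_idem : forall x, carrier O x -> opC O (opC O x) = opC O x
}.

Definition topological_contextual_dba T (O : dbao_sig T) : Prop :=
  topological_dba O /\ contextual O.

Definition topological_pure_dba T (O : dbao_sig T) : Prop :=
  topological_dba O /\ pure O.

Definition dba_restrict T (D : dba_sig T) (U : set T) : dba_sig T :=
  DbaSig U (join D) (meet D) (neg D) (opp D) (top D) (bot D).

Definition dbao_restrict T (O : dbao_sig T) (U : set T) : dbao_sig T :=
  DbaoSig (dba_restrict O U) (opI O) (opC O).

Definition dbao_p T (O : dbao_sig T) : dbao_sig T := dbao_restrict O (dba_p O).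

Record context := Context {
  obj : Type;
  attr : Type;
  incidence : obj -> attr -> Prop
}.

Definition intent (K : context) (A : set (obj K)) : set (attr K) :=
  [set m | forall g, A g -> incidence g m].

Definition extent (K : context) (B : set (attr K)) : set (obj K) :=
  [set g | forall m, B m -> incidence g m].

Definition ctx_pair (K : context) : Type := (set (obj K) * set (attr K))%type.

Definition protoconcepts (K : context) : set (ctx_pair K) :=
  [set x | extent (intent x.1) = extent x.2].

Definition semiconcepts (K : context) : set (ctx_pair K) :=
  [set x | intent x.1 = x.2 \/ extent x.2 = x.1].

Definition ctx_meet (K : context) (x y : ctx_pair K) : ctx_pair K :=
  (x.1 `&` y.1, intent (x.1 `&` y.1)).

Definition ctx_join (K : context) (x y : ctx_pair K) : ctx_pair K :=
  (extent (x.2 `&` y.2), x.2 `&` y.2).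

Definition ctx_neg (K : context) (x : ctx_pair K) : ctx_pair K :=
  (~` x.1, intent (~` x.1)).

Definition ctx_opp (K : context) (x : ctx_pair K) : ctx_pair K :=
  (extent (~` x.2), ~` x.2).

Definition ctx_top (K : context) : ctx_pair K := (setT, set0).

Definition ctx_bot (K : context) : ctx_pair K := (set0, setT).

Record kripke_context := KripkeContext {
  kctx :> context;
  relR : obj kctx -> obj kctx -> Prop;
  relS : attr kctx -> attr kctx -> Prop
}.

Definition kripke_reflexive (KC : kripke_context) : Prop :=
  RelationClasses.Reflexive (@relR KC) /\ RelationClasses.Reflexive (@relS KC).

Definition kripke_transitive (KC : kripke_context) : Prop :=
  RelationClasses.Transitive (@relR KC) /\ RelationClasses.Transitive (@relS KC).

Definition lower_approx (W : Type) (E : W -> W -> Prop) (A : set W) : set W :=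
  [set x | forall y, E x y -> A y].

Definition f_R (KC : kripke_context) (x : ctx_pair KC) : ctx_pair KC :=
  (lower_approx (@relR KC) x.1, intent (lower_approx (@relR KC) x.1)).

Definition f_S (KC : kripke_context) (x : ctx_pair KC) : ctx_pair KC :=
  (extent (lower_approx (@relS KC) x.2), lower_approx (@relS KC) x.2).

Definition proto_alg (KC : kripke_context) : dbao_sig (ctx_pair KC) :=
  DbaoSig
    (DbaSig (@protoconcepts KC) (@ctx_join KC) (@ctx_meet KC) (@ctx_neg KC)
       (@ctx_opp KC) (@ctx_top KC) (@ctx_bot KC))
    (@f_R KC) (@f_S KC).

Definition semi_alg (KC : kripke_context) : dbao_sig (ctx_pair KC) :=
  DbaoSig
    (DbaSig (@semiconcepts KC) (@ctx_join KC) (@ctx_meet KC) (@ctx_neg KC)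
       (@ctx_opp KC) (@ctx_top KC) (@ctx_bot KC))
    (@f_R KC) (@f_S KC).

(* Main.v *)
Require Import Defs.
From mathcomp Require Import all_boot.
From mathcomp Require Import boolp classical_sets.

(** The operations meet, neg and [f_R] only look at the first component [A] of
    a pair and return a pair of the form [(A, A')]; dually, join, opp and [f_S]
    only look at the second component [B] and return [(B', B)].  So each dBa
    identity that involves one of the two families alone is an identity between
    sets: Boolean algebra for meet and neg, and the properties of an interior
    operator for [f_R], which is one because the relation is a preorder.  The
    constants fit the same pattern: [bot] is [(A, A')] for [A] empty and [top]
    is [(B', B)] for [B] empty.  The two families meet only in the absorption
    laws (5a) and (5b), in axiom (12), and in the statements about [sqle]: the
    monotonicity of [f_R] and [f_S], and the comparison of [x] with its images.
    These rest on the Galois connection between intents and extents and on the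
    identities [A'' = B'] and [A' = B''] of a protoconcept [(A, B)].

    The relation [sqle] compares first components by inclusion and second
    components by reverse inclusion ([sqle_pairE]), so it is a partial order
    and the protoconcept algebra is contextual.  An element is idempotent for
    meet exactly when [B = A'], and for join exactly when [A = B'], so the pure
    part of the protoconcept algebra consists of the semiconcepts.  Since every
    operation returns a pair [(A, A')] or [(B', B)], semiconcepts form a
    subalgebra, which inherits the axioms ([topological_dba_restrict]). *)

Set Implicit Arguments.
Unset Strict Implicit.
Unset Printing Implicit Defensive.

Local Open Scope classical_set_scope.

(** * Galois connection and semiconcepts *)

Section Galois.

Variable K : context.
Implicit Types (A : set (obj K)) (B : set (attr K)) (x y z : ctx_pair K).

Lemma extent_intent_sub A : A `<=` extent (intent A).
Proof. by move=> g Ag m; apply. Qed.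

Lemma intent_extent_sub B : B `<=` intent (extent B).
Proof. by move=> m Bm g; apply. Qed.

Lemma intentS A1 A2 : A1 `<=` A2 -> intent A2 `<=` intent A1.
Proof. by move=> sA m Am g /sA; apply: Am. Qed.

Lemma extentS B1 B2 : B1 `<=` B2 -> extent B2 `<=` extent B1.
Proof. by move=> sB g Bg m /sB; apply: Bg. Qed.

Lemma intentK A : intent (extent (intent A)) = intent A.
Proof.
apply/seteqP; split; last exact: intent_extent_sub.
exact/intentS/extent_intent_sub.
Qed.

Lemma extentK B : extent (intent (extent B)) = extent B.
Proof.
apply/seteqP; split; last exact: extent_intent_sub.
exact/extentS/intent_extent_sub.
Qed.

Lemma intent_set0 : intent set0 = setT :> set (attr K).
Proof. by apply/seteqP; split=> // m _ g. Qed.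

Lemma extent_set0 : extent set0 = setT :> set (obj K).
Proof. by apply/seteqP; split=> // g _ m. Qed.

Lemma semi_proto x : semiconcepts x -> protoconcepts x.
Proof. by rewrite /protoconcepts /=; case=> <-; rewrite ?extentK. Qed.

Lemma semi_intent A : semiconcepts (A, intent A).
Proof. by left. Qed.

Lemma semi_extent B : semiconcepts (extent B, B).
Proof. by right. Qed.

Lemma semi_top : semiconcepts (ctx_top K).
Proof. by right; rewrite /= extent_set0. Qed.

Lemma semi_bot : semiconcepts (ctx_bot K).
Proof. by left; rewrite /= intent_set0. Qed.

Lemma proto_intent x : protoconcepts x -> intent x.1 = intent (extent x.2).
Proof. by move=> <-; rewrite intentK. Qed.

Lemma proto_sub_extent x : protoconcepts x -> x.1 `<=` extent x.2.
Proof. by move=> <-; exact: extent_intent_sub. Qed.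

Lemma proto_sub_intent x : protoconcepts x -> x.2 `<=` intent x.1.
Proof. by move=> /proto_intent ->; exact: intent_extent_sub. Qed.

Lemma ctx_meet_idem x : ctx_meet x x = x <-> intent x.1 = x.2.
Proof.
rewrite /ctx_meet setIid; case: x => A B /=; split; first by case.
by move->.
Qed.

Lemma ctx_join_idem x : ctx_join x x = x <-> extent x.2 = x.1.
Proof.
rewrite /ctx_join setIid; case: x => A B /=; split; first by case.
by move->.
Qed.

End Galois.

(** * Lower approximation as an interior operator *)

Section LowerApprox.

Variables (W : Type) (E : W -> W -> Prop).
Implicit Types A B : set W.

Lemma lower_approxS A B :
  A `<=` B -> lower_approx E A `<=` lower_approx E B.
Proof. by move=> sAB x Ax y /Ax /sAB. Qed.

Lemma lower_approxI A B :
  lower_approx E (A `&` B) = lower_approx E A `&` lower_approx E B.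
Proof.
apply/seteqP; split=> x; first by move=> h; split=> y /h [].
by move=> [hA hB] y xy; split; [exact: hA | exact: hB].
Qed.

Lemma lower_approxT : lower_approx E setT = setT.
Proof. by apply/seteqP; split. Qed.

Lemma lower_approx_sub A :
  RelationClasses.Reflexive E -> lower_approx E A `<=` A.
Proof. by move=> Er x; apply. Qed.

Lemma lower_approx_idem A :
  RelationClasses.Reflexive E -> RelationClasses.Transitive E ->
  lower_approx E (lower_approx E A) = lower_approx E A.
Proof.
move=> Er Et; apply/seteqP; split; first exact: lower_approx_sub.
by move=> x h y xy z yz; apply: h; exact: Et xy yz.
Qed.

End LowerApprox.

(** * Subalgebras *)

(** The axioms are universally quantified over the carrier, so a subset of it
    inherits them as soon as it is closed under the operations. *)
Lemma topological_dba_restrict T (O : dbao_sig T) (U : set T) :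
  U `<=` carrier O ->
  (forall x y, U x -> U y -> U (join O x y)) ->
  (forall x y, U x -> U y -> U (meet O x y)) ->
  (forall x, U x -> U (neg O x)) -> (forall x, U x -> U (opp O x)) ->
  U (top O) -> U (bot O) ->
  (forall x, U x -> U (opI O x)) -> (forall x, U x -> U (opC O x)) ->
  topological_dba O -> topological_dba (dbao_restrict O U).
Proof.
move=> sU cj cm cn co ct cb cI cC.
move=> [[[]]] *.
by split; [split; [split|..]|..] => //= *;
  match goal with H : _ |- _ => by apply: H; try exact: sU end.
Qed.

(** * The algebra of protoconcepts and its pure part *)

Section ProtoconceptAlgebra.

Variable KC : kripke_context.
Implicit Types x y z : ctx_pair KC.

(** The meet half of [sqle] only says that the first components are nested: the
    second components of both sides are intents of the first.  Dually for the
    join half, so this holds for arbitrary pairs. *)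
Lemma sqle_pairE x y :
  sqle (proto_alg KC) x y <-> x.1 `<=` y.1 /\ y.2 `<=` x.2.
Proof.
rewrite /sqle /= /ctx_meet /ctx_join !setIid; split.
  by move=> [/(congr1 fst)/setIidPl ? /(congr1 snd)/setIidPr ?].
by move=> [/setIidPl -> /setIidPr ->].
Qed.

Lemma proto_contextual : contextual (proto_alg KC).
Proof.
split=> [x _ | x y z _ _ _ | x y _ _].
- by apply/sqle_pairE; split.
- move=> /sqle_pairE[xy1 yx2] /sqle_pairE[yz1 zy2]; apply/sqle_pairE.
  by split; [exact: subset_trans yz1 | exact: subset_trans yx2].
- move=> /sqle_pairE[xy1 yx2] /sqle_pairE[yx1 xy2].
  by rewrite [x]surjective_pairing [y]surjective_pairing;
    congr pair; apply/seteqP.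
Qed.

Lemma proto_is_dba : is_dba (proto_alg KC).
Proof.
split; rewrite /vee /wedge /=.
- by move=> x y _ _; exact/semi_proto/semi_extent.
- by move=> x y _ _; exact/semi_proto/semi_intent.
- by move=> x _; exact/semi_proto/semi_intent.
- by move=> x _; exact/semi_proto/semi_extent.
- exact/semi_proto/semi_top.
- exact/semi_proto/semi_bot.
- by move=> x y _ _; rewrite /ctx_meet /= setIid.
- by move=> x y _ _; rewrite /ctx_join /= setIid.
- by move=> x y _ _; rewrite /ctx_meet setIC.
- by move=> x y _ _; rewrite /ctx_join setIC.
- by move=> x y z _ _ _; rewrite /ctx_meet /= setIA.
- by move=> x y z _ _ _; rewrite /ctx_join /= setIA.
- by move=> x _; rewrite /ctx_neg /= setIid.
- by move=> x _; rewrite /ctx_opp /= setIid.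
(* (5a): A is contained in B', hence in the extent of any subset of B. *)
- move=> x y px _; rewrite /ctx_meet /= setIid.
  have /setIidPl -> // : x.1 `<=` extent (x.2 `&` y.2).
  apply: subset_trans (proto_sub_extent px) _.
  by apply: extentS; exact: subIsetl.
(* (5b): B is contained in A', hence in the intent of any subset of A. *)
- move=> x y px _; rewrite /ctx_join /= setIid.
  have /setIidPl -> // : x.2 `<=` intent (x.1 `&` y.1).
  apply: subset_trans (proto_sub_intent px) _.
  by apply: intentS; exact: subIsetl.
- by move=> x y z _ _ _; rewrite /ctx_meet /ctx_neg /= -!setCU !setCK setIUr.
- by move=> x y z _ _ _; rewrite /ctx_join /ctx_opp /= -!setCU !setCK setIUr.
- by move=> x y _ _; rewrite /ctx_meet /ctx_neg /= -setCU !setCK setUC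
    setKU setIid.
- by move=> x y _ _; rewrite /ctx_join /ctx_opp /= -setCU !setCK setUC
    setKU setIid.
- by move=> x y _ _; rewrite /ctx_neg /= setCK.
- by move=> x y _ _; rewrite /ctx_opp /= setCK.
- by move=> x _; rewrite /ctx_meet /= setICr intent_set0.
- by move=> x _; rewrite /ctx_join /= setICr extent_set0.
- by rewrite /ctx_neg /ctx_meet /= setC0 setIid.
- by rewrite /ctx_opp /ctx_join /= setC0 setIid.
- by rewrite /ctx_neg /= setCT intent_set0.
- by rewrite /ctx_opp /= setCT extent_set0.
(* (12): both sides equal (A'', A') = (B', B''). *)
- move=> x px; rewrite /ctx_join /ctx_meet /= !setIid.
  by rewrite [extent (intent _)]px (proto_intent px).
Qed.

Lemma proto_is_dbao : is_dbao (proto_alg KC).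
Proof.
split; first exact: proto_is_dba.
- by move=> x _; exact/semi_proto/semi_intent.
- by move=> x _; exact/semi_proto/semi_extent.
- move=> x y _ _ /sqle_pairE[xy _]; apply/sqle_pairE => /=.
  by split; [|apply: intentS]; exact: lower_approxS.
- move=> x y _ _ /sqle_pairE[_ yx]; apply/sqle_pairE => /=.
  by split; [apply: extentS|]; exact: lower_approxS.
- by move=> x y _ _; rewrite /= /f_R /ctx_meet /= lower_approxI.
- by move=> x y _ _; rewrite /= /f_S /ctx_join /= lower_approxI.
- by rewrite /= /f_R /ctx_neg /= setC0 lower_approxT.
- by rewrite /= /f_S /ctx_opp /= setC0 lower_approxT.
- by move=> x _; rewrite /= /f_R /= setIid.
- by move=> x _; rewrite /= /f_S /= setIid.
Qed.

Lemma proto_topological :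
  kripke_reflexive KC -> kripke_transitive KC ->
  topological_dba (proto_alg KC).
Proof.
move=> [Rr Sr] [Rt St]; split; first exact: proto_is_dbao.
(* The second components need B to lie below A', hence below the intent of
   the smaller set that approximates A from below. *)
- move=> x px; apply/sqle_pairE => /=; split; first exact: lower_approx_sub.
  apply: subset_trans (proto_sub_intent px) _.
  by apply: intentS; exact: lower_approx_sub.
- move=> x px; apply/sqle_pairE => /=; split; last exact: lower_approx_sub.
  apply: subset_trans (proto_sub_extent px) _.
  by apply: extentS; exact: lower_approx_sub.
- by move=> x _; rewrite /= /f_R /= lower_approx_idem.
- by move=> x _; rewrite /= /f_S /= lower_approx_idem.
Qed.

Lemma dba_p_proto : dba_p (proto_alg KC) = @semiconcepts KC.
Proof.
apply/seteqP; split=> x.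
  by move=> [_ [/ctx_meet_idem | /ctx_join_idem]]; [left | right].
move=> sx; split; first exact: semi_proto.
by case: sx => ?; [left; apply/ctx_meet_idem | right; apply/ctx_join_idem].
Qed.

Lemma semi_pure : pure (semi_alg KC).
Proof. by move=> x; rewrite -[carrier _]dba_p_proto => -[]. Qed.

Lemma semi_topological :
  topological_dba (proto_alg KC) -> topological_dba (semi_alg KC).
Proof.
apply: (@topological_dba_restrict _ (proto_alg KC) (@semiconcepts KC)) => //=.
- exact: semi_proto.
- by move=> x y _ _; exact: semi_extent.
- by move=> x y _ _; exact: semi_intent.
- by move=> x _; exact: semi_intent.
- by move=> x _; exact: semi_extent.
- exact: semi_top.
- exact: semi_bot.
- by move=> x _; exact: semi_intent.
- by move=> x _; exact: semi_extent.
Qed.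

End ProtoconceptAlgebra.

Theorem theorem21 (KC : kripke_context)
  (hrefl : kripke_reflexive KC) (htrans : kripke_transitive KC) :
  topological_contextual_dba (proto_alg KC) /\
  (dbao_p (proto_alg KC) = semi_alg KC /\ topological_pure_dba (semi_alg KC)).
Proof.
have topP := proto_topological hrefl htrans.
split; first by split; [exact: topP | exact: proto_contextual].
split; first by rewrite /dbao_p dba_p_proto.
by split; [exact: semi_topological | exact: semi_pure].
Qed.
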